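(* Let $n\ge1$ and let $\mu\in\mathbb{Z}_{\ge0}^n$ be a weak composition. Then the attacking graph $\Gamma_\mu$ is isomorphic to the Dyck graph $G_{\mathcal{F}(\mu)}$, where $\mathcal{F}$ is the Dyckification map. In particular, every attacking graph is isomorphic to a Dyck graph.
   Context: **Attacking graph.** For $\mu\in\mathbb{Z}_{\ge0}^n$, the augmented diagram is $\widehat{dg}(\mu)=\{(i,j):1\le i\le n,\ 0\le j\le\mu_i\}$ ($i$ is the column, $j$ the row). Two distinct boxes attack each other if they are in the same row, or they are in consecutive rows and the box in the lower row is in a column strictly to the right of that of the box in the upper row. $\Gamma_\mu$ is the graph with vertex set $\widehat{dg}(\mu)$ in which two boxes are adjacent iff they attack each other. **Dyck graph.** A Dyck path $\delta$ of length $M$ is a lattice path from $(0,0)$ to $(M,M)$ with unit north steps $N$ and unit east steps $E$ staying weakly above the line $y=x$. The Dyck graph $G_\delta$ has vertex set $[M]$, with $i<j$ adjacent iff the point $(i-1,j)$ lies on or below $\delta$. **Dyckification.** Label each box of $\widehat{dg}(\mu)$ by $EN$ if there is a box of $\widehat{dg}(\mu)$ directly above it and by $E$ otherwise. $\mathcal{F}(\mu)$ is the path given by the word consisting of $n$ north steps followed by the labels of the boxes, read row by row from bottom to top and from left to right within each row. It is a Dyck path of length $|\mu|+n$, $|\mu|=\sum_i\mu_i$. *)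

(* Defs.v *)
From HB Require Import structures.
From mathcomp Require Import all_boot.

Set Implicit Arguments.
Unset Strict Implicit.
Unset Printing Implicit Defensive.

Record sgraph := SGraph {
  vertex :> finType;
  adj : rel vertex;
  adj_sym : symmetric adj;
  adj_irrefl : irreflexive adj }.

Definition isomorphic (G H : sgraph) : Prop :=
  exists2 f : G -> H, bijective f & forall x y, adj (f x) (f y) = adj x y.

Variant step := North | East.

Definition is_north (s : step) : bool := if s is North then true else false.
Definition is_east (s : step) : bool := if s is East then true else false.

(* The lattice points of the path with word [w] are
   [(xpos w k, ypos w k)] for [k <= size w]. *)
Definition xpos (w : seq step) (k : nat) : nat := count is_east (take k w).
Definition ypos (w : seq step) (k : nat) : nat := count is_north (take k w).

Record dyck_path (M : nat) := DyckPath {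
  dyck_word :> seq step;
  dyck_endx : xpos dyck_word (size dyck_word) = M;
  dyck_endy : ypos dyck_word (size dyck_word) = M;
  dyck_above : forall k, k <= size dyck_word ->
    xpos dyck_word k <= ypos dyck_word k }.

(* [x] and [y] are integers, so it suffices to compare [(x, y)] with the lattice
   points of the path. *)
Definition on_or_below (w : seq step) (x y : nat) : bool :=
  [exists k : 'I_(size w).+1, (xpos w k == x) && (y <= ypos w k)].

(* The element [i] of ['I_M] stands for the vertex [i + 1] of {1, ..., M}; the
   point (i - 1, j) attached to vertices i < j therefore becomes [(i, j.+1)]. *)
Definition dyck_adj (M : nat) (d : dyck_path M) (i j : 'I_M) : bool :=
  ((i < j) && on_or_below d i j.+1) || ((j < i) && on_or_below d j i.+1).

Lemma dyck_adj_sym M (d : dyck_path M) : symmetric (dyck_adj d).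
Proof. by move=> i j; rewrite /dyck_adj orbC. Qed.

Lemma dyck_adj_irrefl M (d : dyck_path M) : irreflexive (dyck_adj d).
Proof. by move=> i; rewrite /dyck_adj ltnn. Qed.

Definition dyck_graph (M : nat) (d : dyck_path M) : sgraph :=
  SGraph (dyck_adj_sym d) (dyck_adj_irrefl d).

(* Columns are numbered from 0 to n - 1 instead of from 1 to n. *)
Definition box (n : nat) (mu : 'I_n -> nat) : finType :=
  {i : 'I_n & 'I_(mu i).+1}.

Definition col (n : nat) (mu : 'I_n -> nat) (b : box mu) : 'I_n := tag b.
Definition row (n : nat) (mu : 'I_n -> nat) (b : box mu) : nat := tagged b.

Definition attack (n : nat) (mu : 'I_n -> nat) (b c : box mu) : bool :=
  (b != c) &&
  [|| row b == row c,
      (row c == (row b).+1) && (col c < col b)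
    | (row b == (row c).+1) && (col b < col c)].

Lemma attack_sym n (mu : 'I_n -> nat) : symmetric (@attack n mu).
Proof.
move=> b c; rewrite /attack eq_sym [row b == row c]eq_sym; congr (_ && (_ || _)).
exact: orbC.
Qed.

Lemma attack_irrefl n (mu : 'I_n -> nat) : irreflexive (@attack n mu).
Proof. by move=> b; rewrite /attack eqxx. Qed.

Definition attacking_graph (n : nat) (mu : 'I_n -> nat) : sgraph :=
  SGraph (@attack_sym n mu) (@attack_irrefl n mu).

Definition reading_le (n : nat) (mu : 'I_n -> nat) (b c : box mu) : bool :=
  (row b < row c) || ((row b == row c) && (col b <= col c)).

Definition reading (n : nat) (mu : 'I_n -> nat) : seq (box mu) :=
  sort (@reading_le n mu) (enum (box mu)).

Definition has_above (n : nat) (mu : 'I_n -> nat) (b : box mu) : bool :=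
  [exists c : box mu, (col c == col b) && (row c == (row b).+1)].

Definition label (n : nat) (mu : 'I_n -> nat) (b : box mu) : seq step :=
  if has_above b then [:: East; North] else [:: East].

Definition dyckification_word (n : nat) (mu : 'I_n -> nat) : seq step :=
  nseq n North ++ flatten [seq label b | b <- reading mu].

Section DyckificationIsDyck.
Variables (n : nat) (mu : 'I_n -> nat).
Implicit Types b c : box mu.

Lemma box_eqP b c : col b = col c -> row b = row c -> b = c.
Proof.
case: b c => [i p] [j q]; rewrite /col /row /= => eij; subst j => /= epq.
by congr (existT _ i _); apply: val_inj.
Qed.

Lemma has_aboveE b : has_above b = (row b < mu (col b)).
Proof.
case: b => i p; rewrite /row /col /=; apply/existsP/idP.
  by case=> -[j q] /andP[/eqP /= ej /eqP]; rewrite /col /row /= in ej *;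
    subst j => <-; rewrite -ltnS.
move=> lt_p; exists (Tagged (fun i => 'I_(mu i).+1) (Ordinal (lt_p : p.+1 < (mu i).+1))).
by rewrite /col /row /= !eqxx.
Qed.

Lemma reading_le_total : total (@reading_le n mu).
Proof.
move=> b c; rewrite /reading_le.
by case: (ltngtP (row b) (row c)) => //= _; apply: leq_total.
Qed.

Lemma reading_le_trans : transitive (@reading_le n mu).
Proof.
move=> c b d; rewrite /reading_le.
case/orP=> [lbc|/andP[/eqP ebc cbc]]; case/orP=> [lcd|/andP[/eqP ecd ccd]].
- by rewrite (ltn_trans lbc lcd).
- by rewrite -ecd lbc.
- by rewrite ebc lcd.
- by rewrite ebc ecd eqxx (leq_trans cbc ccd) orbT.
Qed.

Lemma reading_sorted : sorted (@reading_le n mu) (reading mu).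
Proof. exact: (sort_sorted reading_le_total). Qed.

Lemma mem_reading b : b \in reading mu.
Proof. by rewrite mem_sort mem_enum. Qed.

Lemma reading_uniq : uniq (reading mu).
Proof. by rewrite sort_uniq enum_uniq. Qed.

Lemma size_reading : size (reading mu) = \sum_i mu i + n.
Proof.
rewrite size_sort -cardE card_tagged sumnE big_map big_enum /=.
under eq_bigr do rewrite card_ord -addn1.
by rewrite big_split /= sum1_card card_ord.
Qed.

Lemma index_reading_lt b c : row b < row c ->
  index b (reading mu) < index c (reading mu).
Proof.
move=> lbc; rewrite ltnNge; apply/negP=> le_cb.
have refl : reflexive (@reading_le n mu).
  by move=> d; rewrite /reading_le eqxx leqnn orbT.
have := sorted_leq_index reading_le_trans refl reading_sorted c b
  (mem_reading c) (mem_reading b) le_cb.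
by rewrite /reading_le ltnNge (ltnW lbc) (gtn_eqF lbc).
Qed.

Definition box_below b : box mu :=
  Tagged (fun i => 'I_(mu i).+1) (inord (row b).-1 : 'I_(mu (col b)).+1).

Lemma col_below b : col (box_below b) = col b. Proof. by []. Qed.

Lemma row_below b : row (box_below b) = (row b).-1.
Proof.
rewrite /row /box_below /= inordK //.
by apply: leq_ltn_trans (leq_pred _) _; apply: ltn_ord.
Qed.

Lemma reading_slack m : m < size (reading mu) ->
  m < n + count (@has_above n mu) (take m (reading mu)).
Proof.
move=> lt_m; set r := reading mu.
pose g b : 'I_n + box mu := if row b == 0 then inl (col b) else inr (box_below b).
have g_inj : injective g.
  move=> b c; rewrite /g; case: eqP => [b0|/eqP b0]; case: eqP => [c0|/eqP c0] //.
    by move=> e; have {e}ebc := inl_inj e; apply: box_eqP => //; rewrite b0 c0.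
  move=> e; have {e}ebc := inr_inj e; apply: box_eqP; first by rewrite -col_below ebc col_below.
  have := congr1 (@row n mu) ebc; rewrite !row_below => e.
  by by rewrite -(prednK (n := row b)) ?lt0n // e prednK ?lt0n.
have -> : m.+1 = size (map g (take m.+1 r)).
  by rewrite size_map size_takel.
have -> : n + count (@has_above n mu) (take m r) =
    size (map inl (enum 'I_n) ++ map inr (filter (@has_above n mu) (take m r))
          : seq ('I_n + box mu)).
  by rewrite size_cat (size_map inl) (size_map inr) size_enum_ord size_filter.
apply: uniq_leq_size.
  by rewrite map_inj_uniq // take_uniq ?reading_uniq.
move=> _ /mapP[b b_in ->]; rewrite mem_cat /g; case: eqP => [_|/eqP b0].
  by rewrite map_f ?mem_enum.
apply/orP; right; apply: map_f; rewrite mem_filter has_aboveE row_below col_below.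
have lt_b : (row b).-1 < row b by rewrite prednK ?lt0n.
apply/andP; split; first by apply: leq_trans lt_b _; rewrite -ltnS; apply: ltn_ord.
rewrite in_take ?mem_reading //; rewrite in_take ?mem_reading // in b_in.
rewrite ltnS in b_in; apply: leq_trans b_in.
by apply: index_reading_lt; rewrite row_below.
Qed.

Lemma labels_above a (s : seq (box mu)) k :
    (forall m, m < size s -> m < a + count (@has_above n mu) (take m s)) ->
  xpos (flatten [seq label b | b <- s]) k <=
  a + ypos (flatten [seq label b | b <- s]) k.
Proof.
rewrite /xpos /ypos; elim: s a k => [|b s IHs] a k slack //=.
have a_gt0 : 0 < a by have := slack 0 isT; rewrite /= addn0.
have IH k' : count is_east (take k' (flatten [seq label b | b <- s])) <=
   (a + has_above b).-1 + count is_north (take k' (flatten [seq label b | b <- s])).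
  apply: IHs => m lt_m; have := slack m.+1 lt_m => /=.
  rewrite addnA -[in X in X -> _](prednK (n := a + has_above b)) ?addSn ?ltnS //.
  by rewrite addn_gt0 a_gt0.
rewrite /label; case: (has_above b) IH => IH; case: k => [|k] //=.
  case: k => [|k] /=; first by rewrite addn0 addn_gt0 a_gt0.
  have := IH k; rewrite addn1 /= !add0n !add1n => le_k.
  by rewrite addnS ltnS.
by have := IH k; rewrite addn0 add1n add0n -ltnS -addSn prednK.
Qed.

Lemma count_east_labels (s : seq (box mu)) :
  count is_east (flatten [seq label b | b <- s]) = size s.
Proof. by elim: s => //= b s IHs; rewrite count_cat IHs /label; case: ifP. Qed.

Lemma count_north_labels (s : seq (box mu)) :
  count is_north (flatten [seq label b | b <- s]) = count (@has_above n mu) s.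
Proof. by elim: s => //= b s IHs; rewrite count_cat IHs /label; case: ifP. Qed.

Lemma count_has_above : count (@has_above n mu) (reading mu) = \sum_i mu i.
Proof.
rewrite count_sort -sum1_count big_enum_cond /=.
rewrite (eq_bigl (fun b : box mu => true && (tagged b < mu (tag b)))); last first.
  by move=> b; rewrite has_aboveE.
rewrite -(sig_big_dep (fun=> true) (fun i (j : 'I_(mu i).+1) => j < mu i)
  (fun _ _ => 1)) /=.
apply: eq_bigr => i _; rewrite big_mkcond big_ord_recr /= ltnn addn0.
by rewrite (eq_bigr (fun=> 1)) ?sum1_card ?card_ord // => j _; rewrite ltn_ord.
Qed.

Lemma dyckification_endx :
  xpos (dyckification_word mu) (size (dyckification_word mu)) = \sum_i mu i + n.
Proof.
by rewrite /xpos take_size count_cat count_nseq count_east_labels size_reading.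
Qed.

Lemma dyckification_endy :
  ypos (dyckification_word mu) (size (dyckification_word mu)) = \sum_i mu i + n.
Proof.
rewrite /ypos take_size count_cat count_nseq count_north_labels.
by rewrite count_has_above mul1n addnC.
Qed.

Lemma dyckification_above k : k <= size (dyckification_word mu) ->
  xpos (dyckification_word mu) k <= ypos (dyckification_word mu) k.
Proof.
move=> _; rewrite /xpos /ypos /dyckification_word take_cat size_nseq.
case: ifP => [lt_kn|_]; first by rewrite take_nseq ?count_nseq // ltnW.
rewrite !count_cat !count_nseq mul0n mul1n add0n.
exact: labels_above reading_slack.
Qed.

End DyckificationIsDyck.

Definition dyckification (n : nat) (mu : 'I_n -> nat) :
    dyck_path (\sum_i mu i + n) :=
  DyckPath (dyckification_endx mu) (dyckification_endy mu)
    (@dyckification_above n mu).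

(* Main.v *)
Require Import Defs.
From mathcomp Require Import all_boot.

(** The isomorphism sends a box to its position in the reading order. The highest
    point of the path on the vertical line of a box [b] has height [n] plus the
    number of boxes read before [b] that have a box above them. This counts the
    [n] bottom boxes and the boxes lying directly above a box read before [b],
    which together form the initial segment of the reading order consisting of
    the rows up to that of [b] and the part of the next row strictly to the left
    of [b]. Hence a box read after [b] lies in this segment iff it attacks [b]. *)

(** The East step after [w1] leaves the vertical line reached by [w1], so the end of [w1] is the
    highest point of the path on that line. *)
Lemma on_or_below_east (w1 w2 : seq step) (y : nat) :
  on_or_below (w1 ++ East :: w2) (count is_east w1) y = (y <= count is_north w1).
Proof.
apply/existsP/idP => [[k /andP[/eqP xk le_y]]|le_y].
  apply: leq_trans le_y _; case: (leqP k (size w1)) => [le_k|lt_k].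
    by rewrite /ypos takel_cat // -[in leqRHS](cat_take_drop k w1) count_cat leq_addr.
  (* A prefix longer than [w1] contains this East step, so it ends strictly to the right of the
     line. *)
  move: xk; rewrite /xpos take_cat ltnNge (ltnW lt_k) /= count_cat.
  rewrite -(subnSK lt_k) /= addnA addn1 => /eqP.
  by rewrite gtn_eqF // ltnS leq_addr.
have lt_w : size w1 < (size (w1 ++ East :: w2)).+1 by rewrite ltnS size_cat leq_addr.
by exists (Ordinal lt_w); rewrite /xpos /ypos /= take_size_cat // eqxx.
Qed.

(** Sortedness for this relation means that nothing failing [P] precedes anything satisfying it, so
    the elements satisfying [P] form a prefix of [s]. *)
Lemma count_downset (T : Type) (P : pred T) (x0 : T) (s : seq T) (j : nat) :
    sorted (fun x y => P y ==> P x) s -> j < size s ->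
  P (nth x0 s j) = (j < count P s).
Proof.
have tr : transitive (fun x y => P y ==> P x).
  by move=> y x z; case: (P x) (P y) (P z) => [] [] [].
elim: s j => // x s IHs j /= s_sorted lt_j.
have := order_path_min tr s_sorted; case: (boolP (P x)) => [Px _|nPx].
  by case: j lt_j => [|j] lt_j; rewrite ?Px // add1n ltnS IHs // (path_sorted s_sorted).
rewrite (eq_all (a2 := predC P)) => [nPs|y /=]; last by rewrite implybF.
have /eqP -> : count P s == 0 by rewrite -leqn0 leqNgt -has_count -all_predC.
apply: negbTE; case: j lt_j => // j lt_j.
exact: all_nthP nPs j lt_j.
Qed.

Section Reading.
Variables (n : nat) (mu : 'I_n -> nat).
Implicit Types b c d : box mu.

Definition segment b : pred (box mu) := fun c =>
  (row c <= row b) || (row c == (row b).+1) && (col c < col b).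

Lemma segment_sorted b :
  sorted (fun c d => segment b d ==> segment b c) (reading mu).
Proof.
apply: sub_sorted (reading_sorted mu) => c d le_cd; apply/implyP.
rewrite /segment; case/orP: le_cd => [lt_cd|/andP[/eqP -> le_cd]].
  case/orP=> [le_db|/andP[/eqP e _]]; first by rewrite (leq_trans (ltnW lt_cd)).
  by rewrite -ltnS -e lt_cd.
by case/orP=> [->//|/andP[-> lt_db]]; rewrite (leq_ltn_trans le_cd lt_db) orbT.
Qed.

Lemma index_readingE b c :
  (index b (reading mu) < index c (reading mu)) =
  (row b < row c) || (row b == row c) && (col b < col c).
Proof.
have refl : reflexive (@reading_le n mu).
  by move=> d; rewrite /reading_le eqxx leqnn orbT.
have le d e : index d (reading mu) <= index e (reading mu) -> reading_le d e.
  exact: (sorted_leq_index (@reading_le_trans n mu) refl (reading_sorted mu)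
    d e (mem_reading d) (mem_reading e)).
case: (ltngtP (row b) (row c)) => /= [/index_reading_lt //|lt_cb|e].
  by apply/negbTE; rewrite -leqNgt ltnW // index_reading_lt.
apply/idP/idP => [lt_i|]; last first.
  rewrite !ltnNge; apply: contra => /le.
  by rewrite /reading_le e ltnn eqxx.
have := le _ _ (ltnW lt_i); rewrite /reading_le e ltnn eqxx /= leq_eqVlt.
case/orP=> // /eqP/val_inj ec.
by rewrite (box_eqP ec e) ltnn in lt_i.
Qed.

(** A box read after [b] is never in a lower row, which rules out the attack from the row below and
    turns [row c <= row b] into equality. *)
Lemma attackE b c : index b (reading mu) < index c (reading mu) ->
  attack b c = segment b c.
Proof.
move=> lt_i; rewrite /attack /segment.
have -> /= : b != c by apply: contraTneq lt_i => ->; rewrite ltnn.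
move: lt_i; rewrite index_readingE; case: (ltngtP (row b) (row c)) => //= lt_bc _.
by rewrite [row b == _]ltn_eqF ?orbF // ltnS ltnW.
Qed.

Lemma count_reading (P : pred (box mu)) : count P (reading mu) = #|P|.
Proof. by rewrite count_sort -sum1_count big_enum_cond sum1_card. Qed.

Lemma card_bottom : #|[set c : box mu | row c == 0]| = n.
Proof.
pose f i : box mu := Tagged (fun i => 'I_(mu i).+1) (ord0 : 'I_(mu i).+1).
have f_inj : injective f by move=> i j /(congr1 (@col n mu)).
rewrite -[RHS]card_ord -(card_imset _ f_inj); apply: eq_card => c.
rewrite inE; apply/eqP/imsetP => [c0|[i _ ->] //].
by exists (col c) => //; apply: box_eqP.
Qed.

(** The bottom row contributes [n]. On the rest of the segment, [box_below] is a bijection onto the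
    boxes read before [b] that have a box above them. *)
Lemma count_segment b : count (segment b) (reading mu) =
  n + count (@has_above n mu) (take (index b (reading mu)) (reading mu)).
Proof.
set r := reading mu.
have below_lt c : row c != 0 -> (row c).-1 < row c by rewrite -lt0n => /prednK ->.
have -> : count (@has_above n mu) (take (index b r) r) =
    #|[set d | has_above d & index d r < index b r]|.
  have u_take := take_uniq (index b r) (reading_uniq mu).
  rewrite -size_filter -(card_uniqP (filter_uniq _ u_take)).
  by apply: eq_card => d; rewrite inE mem_filter in_take ?mem_reading.
rewrite count_reading -cardsE -(cardsID [set c | row c == 0]); congr (_ + _).
  rewrite -[RHS]card_bottom; apply: eq_card => c; rewrite !inE.
  by case: eqP => [c0|_]; rewrite ?andbF // unfold_in /segment c0.
(* Injectivity holds only off the bottom row: the truncated predecessor makes [box_below] fix the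
   bottom boxes. *)
rewrite -(card_in_imset (f := @box_below n mu)); last first.
  move=> c d; rewrite !inE => /andP[c0 _] /andP[d0 _] e; apply: box_eqP.
    exact: (congr1 (@col n mu) e).
  have /= := congr1 (@row n mu) e; rewrite !row_below => /(congr1 succn).
  by rewrite !prednK ?lt0n.
apply: eq_card => d; rewrite inE index_readingE; apply/imsetP/andP.
  case=> c; rewrite !inE => /andP[c0 cb] ->; rewrite has_aboveE row_below col_below.
  split; first by rewrite -ltnS (leq_ltn_trans (below_lt c c0)) // ltn_ord.
  by move: cb; rewrite unfold_in /segment; case: (row c) c0.
case=> /existsP[c /andP[/eqP cd /eqP rc]] lt_db; exists c.
  by rewrite !inE unfold_in /segment rc /= eqSS cd.
by apply: box_eqP; rewrite ?row_below ?rc ?col_below.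
Qed.

Lemma on_or_below_dyckification b y :
  on_or_below (dyckification_word mu) (index b (reading mu)) y =
  (y <= count (segment b) (reading mu)).
Proof.
set r := reading mu; set i := index b r.
have i_lt : i < size r by rewrite index_mem mem_reading.
(* The path just before the label of [b]. Each label starts with its only East step, so [w1] has [i]
   East steps and another one follows it. *)
pose w1 := nseq n North ++ flatten [seq label c | c <- take i r].
have [w2 ->] : exists w2, dyckification_word mu = w1 ++ East :: w2.
  rewrite /dyckification_word -/r -(cat_take_drop i r) (drop_nth b i_lt).
  rewrite map_cat flatten_cat /= /label.
  by case: ifP => _; rewrite catA /=; eexists.
have <- : count is_east w1 = i.
  by rewrite count_cat count_nseq count_east_labels size_takel // ltnW.
rewrite on_or_below_east count_segment count_cat count_nseq mul1n.
by rewrite count_north_labels.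
Qed.

Lemma index_reading_bound b : index b (reading mu) < \sum_i mu i + n.
Proof. by rewrite -size_reading index_mem mem_reading. Qed.

Definition reading_rank b : 'I_(\sum_i mu i + n) := Ordinal (index_reading_bound b).

Lemma reading_rank_bij : bijective reading_rank.
Proof.
apply: inj_card_bij => [b c /(congr1 val) /= e|].
  exact: (index_inj b (mem_reading b) (mem_reading c) e).
by rewrite card_ord -size_reading size_sort -cardE.
Qed.

Lemma dyck_adj_reading_rank b c : reading_rank b < reading_rank c ->
  dyck_adj (dyckification mu) (reading_rank b) (reading_rank c) = attack b c.
Proof.
rewrite /dyck_adj /= => lt_bc.
rewrite lt_bc ltnNge (ltnW lt_bc) orbF /= on_or_below_dyckification attackE //.
(* The height is the rank of [c] plus one, so the inequality says that the position of [c] lies in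
   the prefix formed by [segment b]. *)
rewrite -(count_downset _ _ b _ _ (segment_sorted b)) ?index_mem ?mem_reading //.
by rewrite nth_index // mem_reading.
Qed.

End Reading.

Theorem theorem3p3 (n : nat) (mu : 'I_n -> nat) (hn : 1 <= n) :
  isomorphic (attacking_graph mu) (dyck_graph (dyckification mu)) /\
  (exists (M : nat) (d : dyck_path M),
     isomorphic (attacking_graph mu) (dyck_graph d)).
Proof.
have iso : isomorphic (attacking_graph mu) (dyck_graph (dyckification mu)).
  exists (reading_rank n mu); first exact: reading_rank_bij.
  move=> b c /=; case: (ltngtP (reading_rank _ _ b) (reading_rank _ _ c)) => [lt|lt|e].
  - exact: dyck_adj_reading_rank.
  - by rewrite dyck_adj_sym attack_sym; apply: dyck_adj_reading_rank.
  - have -> := bij_inj (reading_rank_bij n mu) (val_inj e).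
    by rewrite dyck_adj_irrefl attack_irrefl.
by split=> //; exists (\sum_i mu i + n), (dyckification mu).
Qed.
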